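(* Let $k\ge 1$ and $r\ge 2$ be integers, and let $T$ be a tree on $k+1$ vertices with maximum degree $\Delta(T)$. If $k \le r$, then for every positive integer $n$, \[\mathrm{ex}_r(n,\text{Berge-}T) \leq (\Delta(T)-1)n.\]
   Context: All graphs and hypergraphs are finite and simple. A hypergraph $\mathcal{H}$ contains a Berge-$F$ (Berge copy of the graph $F$) if there are an injection $\varphi:V(F)\to V(\mathcal{H})$ and an injection $f:E(F)\to E(\mathcal{H})$ with $\{\varphi(u),\varphi(v)\}\subset f(uv)$ for every edge $uv\in E(F)$; otherwise it is Berge-$F$-free. $\mathrm{ex}_r(n,\text{Berge-}F)$ is the maximum number of hyperedges in an $n$-vertex $r$-uniform Berge-$F$-free hypergraph. *)

(* Defs.v *)
From mathcomp Require Import all_boot.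

Set Implicit Arguments.
Unset Strict Implicit.
Unset Printing Implicit Defensive.

Record sgraph := SGraph {
  vertex :> finType;
  adj : rel vertex;
  adj_sym : symmetric adj;
  adj_irr : irreflexive adj
}.

Definition edges (G : sgraph) : {set {set G}} :=
  [set [set p.1; p.2] | p : G * G & adj p.1 p.2].

Definition degree (G : sgraph) (x : G) : nat := #|[set y | adj x y]|.

Definition max_degree (G : sgraph) : nat := \max_(x : G) degree x.

Definition connected (G : sgraph) : Prop :=
  forall x y : G, connect (@adj G) x y.

(* [:: x; y] is a [ucycle] as soon as [adj x y], so the cycles of the graph are
   the [ucycle]s of length at least 3. *)
Definition acyclic (G : sgraph) : Prop :=
  forall c : seq G, ucycle (@adj G) c -> size c < 3.

(* The null graph satisfies this; a vertex count has to be imposed separately. *)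
Definition is_tree (G : sgraph) : Prop := connected G /\ acyclic G.

(* A simple hypergraph on the vertex set V is its set H of hyperedges. *)
Definition uniform (V : finType) (r : nat) (H : {set {set V}}) : bool :=
  [forall A in H, #|A| == r].

(* The map f is total on {set F}, but only its values on [edges F] matter. *)
Definition contains_berge (F : sgraph) (V : finType) (H : {set {set V}}) :
    bool :=
  [exists phi : {ffun F -> V}, exists f : {ffun {set F} -> {set V}},
    [&& injectiveb phi,
        dinjectiveb f (edges F),
        [forall A in edges F, f A \in H]
      & [forall u, forall v,
          adj u v ==> ([set phi u; phi v] \subset f [set u; v])]]].

(* The n-vertex hypergraphs are taken on the vertex set 'I_n.  The maximum is
   over a nonempty family when F has an edge (take H empty); otherwise it may be
   the default value 0. *)
Definition ex_berge (r n : nat) (F : sgraph) : nat :=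
  \max_(H : {set {set 'I_n}} | uniform r H && ~~ contains_berge F H) #|H|.

Lemma contains_bergeP (F : sgraph) (V : finType) (H : {set {set V}}) :
  reflect
    (exists (phi : F -> V) (f : {set F} -> {set V}),
      [/\ injective phi,
          {in edges F &, injective f},
          {in edges F, forall A, f A \in H}
        & forall u v, adj u v -> [set phi u; phi v] \subset f [set u; v]])
    (contains_berge F H).
Proof.
apply: (iffP existsP) => [[phi /existsP[f]] | [phi [f [phiI fI fH sub]]]].
  case/and4P=> /injectiveP phiI /dinjectiveP fI /forall_inP fH /forallP sub.
  exists phi, f; split=> // u v uv.
  by move/forallP/(_ v)/implyP: (sub u); apply.
exists [ffun x => phi x]; apply/existsP; exists [ffun A => f A].
apply/and4P; split.
- by apply/injectiveP => x y; rewrite !ffunE; apply: phiI.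
- by apply/dinjectiveP => A B AE BE; rewrite !ffunE; apply: fI.
- by apply/forall_inP => A AE; rewrite ffunE; apply: fH.
- by apply/forallP=> u; apply/forallP=> v; apply/implyP=> uv; rewrite !ffunE sub.
Qed.

(* Main.v *)
Require Import Defs.
From mathcomp Require Import all_boot zify.

(* Put m = Delta(T) - 1 and suppose |H| > m n.  Assign hyperedges to vertices
   lying in them, at most m to each vertex and as many hyperedges as possible.
   Some hyperedge e0 stays unassigned; since no augmenting path exists, every
   vertex reachable from e0 by alternating paths owns exactly m hyperedges, and
   these are contained in the set W of reachable vertices.  Give e0 to one of
   its vertices v0 as well.
   Now map the root of T to v0 and embed T greedily inside W, using for each
   edge from a parent to a child a hyperedge owned by the image of the parent:
   the root has at most m + 1 children and every other vertex at most m, so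
   distinct hyperedges are always available.  As long as fewer than r vertices
   have been placed, a hyperedge has room for a new one; when k = r this fails
   only for the very last vertex, which is handled together with the last but
   one, both being leaves. *)

Set Implicit Arguments.
Unset Strict Implicit.
Unset Printing Implicit Defensive.

(** * Building a tree from a root by adding leaves *)

Section TreeOrder.

Variable T : sgraph.
Implicit Types (A : seq T) (s : seq (T * T)).

Definition adj_in A : rel T := [rel x y | [&& adj x y, x \in A & y \in A]].

Definition connected_in A := {in A &, forall x y, connect (adj_in A) x y}.

Lemma adj_in_connect_sym A : connect_sym (adj_in A).
Proof.
apply: sym_connect_sym => x y; rewrite /adj_in /=.
by rewrite adj_sym; congr (_ && _); rewrite andbC.
Qed.

(** If [x] and [y] differed, a simple path joining them inside [A] would close up through [z] to a
    cycle of length at least 3. *)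
Lemma acyclic_uniq_neighbour A (z x y : T) :
    acyclic T -> connected_in A -> z \notin A ->
  x \in A -> y \in A -> adj z x -> adj z y -> x = y.
Proof.
move=> acT cA zA xA yA zx zy.
have /connectP[p0] := cA _ _ xA yA; case/shortenP=> p pathp Up _ yE.
case: p => [|u p] in pathp Up yE *; first by rewrite yE.
have inA : all (mem A) (u :: p).
  elim: {u p}(u :: p) (x) pathp {Up yE} => //= u p IHp v.
  by case/andP=> /and3P[_ _ uA] /IHp ->; rewrite andbT.
suff /acT : ucycle (@adj T) [:: z, x, u & p] by [].
apply/andP; split; last first.
  rewrite cons_uniq Up andbT inE negb_or; apply/andP; split.
    by apply: contraNneq zA => ->.
  by apply: contra zA => /(allP inA).
rewrite /cycle rcons_path -[last _ _]/(last x (u :: p)) -yE adj_sym zy andbT.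
rewrite -[path _ _ _]/(adj z x && path (@adj T) x (u :: p)) zx.
by apply: sub_path pathp => v w /and3P[].
Qed.

(* The pairs of [s] are (child, parent), the most recently added child first:
   each child is a leaf of the tree built so far, hanging from its parent. *)
Fixpoint tree_order (r : T) s : Prop :=
  if s is (x, p) :: s' then
    [/\ x \notin r :: unzip1 s', p \in r :: unzip1 s',
        {in r :: unzip1 s', forall y, adj x y = (y == p)} & tree_order r s']
  else True.

Lemma tree_order_uniq r s : tree_order r s -> uniq (r :: unzip1 s).
Proof.
elim: s => [//|[x p] s IHs] /= [xs _ _ /IHs /= /andP[rs ->]].
by move: xs; rewrite !inE !negb_or rs eq_sym => /andP[-> ->].
Qed.

Lemma tree_order_parent r s i :
  tree_order r s -> i \in s -> i.2 \in r :: unzip1 s.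
Proof.
elim: s => [//|[x p] s IHs] /= [_ ps _ /IHs{}IHs].
have sub : {subset r :: unzip1 s <= [:: r, x & unzip1 s]}.
  by move=> y; rewrite !inE => /orP[] -> //; rewrite !orbT.
by rewrite inE => /predU1P[-> | /IHs]; apply: sub.
Qed.

Lemma tree_order_connected r s :
  tree_order r s -> connected_in (r :: unzip1 s).
Proof.
move=> ts; suff r_conn y : y \in r :: unzip1 s ->
    connect (adj_in (r :: unzip1 s)) r y.
  move=> x y /r_conn rx /r_conn; apply: connect_trans.
  by rewrite adj_in_connect_sym.
elim: s ts y => [_ y|[x p] s IHs] /=.
  by rewrite mem_seq1 => /eqP->; apply: connect0.
move=> [xs ps adjx /IHs{}IHs] y.
have sub : {subset r :: unzip1 s <= [:: r, x & unzip1 s]}.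
  by move=> z; rewrite !inE => /orP[] -> //; rewrite !orbT.
have mono z : z \in r :: unzip1 s -> connect (adj_in [:: r, x & unzip1 s]) r z.
  move/IHs; apply: connect_sub => u v /and3P[uv us vs].
  by apply: connect1; apply/and3P; split=> //; apply: sub.
have [ys _ | ys] := boolP (y \in r :: unzip1 s); first exact: mono.
rewrite !inE => /or3P[yr | /eqP-> | y1];
  try by rewrite !inE ?yr ?y1 ?orbT in ys.
apply: connect_trans (mono p ps) (connect1 _).
by rewrite /adj_in /= adj_sym adjx // eqxx sub // !inE eqxx orbT.
Qed.

(** As long as [A] is not exhausted, connectivity gives an edge leaving the current tree. Acyclicity
    makes its outer end a leaf of the enlarged tree. *)
Lemma tree_order_exists A r :
    acyclic T -> connected_in A -> r \in A ->
  exists2 s, tree_order r s & r :: unzip1 s =i A.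
Proof.
move=> acT cA rA.
have grow n : exists s, [/\ tree_order r s, {subset r :: unzip1 s <= A}
    & size s = n \/ r :: unzip1 s =i A].
  elim: n => [|n [s [ts sA [size_s | eqA]]]]; last by exists s; split; auto.
    exists [::]; split=> //; last by left.
    by move=> y; rewrite mem_seq1 => /eqP->.
  case: (boolP [exists x, exists y,
      [&& x \in r :: unzip1 s, y \notin r :: unzip1 s & adj_in A x y]]).
    case/existsP=> x /existsP[y /and3P[xs ys /and3P[xy xA yA]]].
    exists ((y, x) :: s); split; last by left; rewrite /= size_s.
    - split=> // z zs; apply/idP/eqP => [yz | ->]; last by rewrite adj_sym.
      apply: acyclic_uniq_neighbour acT (tree_order_connected ts) ys zs xs yz _.
      by rewrite adj_sym.
    - move=> z; rewrite !inE => /or3P[zr | /eqP-> // | zs].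
        by apply: sA; rewrite inE zr.
      by apply: sA; rewrite inE zs orbT.
  move=> nocross; exists s; split=> //; right=> y.
  have closedA : closed (adj_in A) (mem (r :: unzip1 s)).
    apply: (intro_closed (@adj_in_connect_sym A)) => u v uv us.
    apply: contraR nocross => vs.
    by apply/existsP; exists u; apply/existsP; exists v; rewrite us vs.
  apply/idP/idP => [/sA // | yA].
  have rs : r \in mem (r :: unzip1 s) by apply: mem_head.
  by have := closed_connect closedA (cA _ _ rA yA); rewrite rs => <-.
have [s [ts sA [size_s | eqA]]] := grow (size A); last by exists s.
(* Otherwise [r :: unzip1 s] lists [size A + 1] distinct elements of [A]. *)
have := uniq_leq_size (tree_order_uniq ts) sA.
by rewrite /= size_map size_s ltnn.
Qed.

(** A neighbour of [p] is either a child of [p] or its parent, and only the root has no parent. *)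
Lemma tree_order_degree r s p :
    tree_order r s -> p \in r :: unzip1 s ->
  count (adj p) (r :: unzip1 s) = count (fun i => i.2 == p) s + (p != r).
Proof.
elim: s => [_|[x q] s IHs] /=.
  by rewrite mem_seq1 => /eqP->; rewrite adj_irr eqxx.
move=> [xs qs adjx ts]; have Us := tree_order_uniq ts.
have [-> _ | px] := eqVneq p x.
  have -> : (q == x) = false by apply: contraNF xs => /eqP <-.
  have -> : count (fun i => i.2 == x) s = 0.
    apply/eqP; rewrite -leqn0 leqNgt -has_count.
    apply: contra xs => /hasP[i /(tree_order_parent ts) + /eqP].
    by move=> + <-.
  have -> : x != r by apply: contraNneq xs => ->; rewrite mem_head.
  rewrite adj_irr !add0n -/(count (adj x) (r :: unzip1 s)).
  by rewrite (eq_in_count (a2 := pred1 q)) ?count_uniq_mem ?qs.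
rewrite !inE (negPf px) /= => ps.
rewrite [adj p x]adj_sym adjx; last by rewrite inE.
have := IHs ts; rewrite inE ps /= => /(_ isT) IH.
by rewrite addnCA IH eq_sym addnA.
Qed.

Lemma tree_order_edge r s x y :
    tree_order r s -> x \in r :: unzip1 s -> y \in r :: unzip1 s -> adj x y ->
  exists2 i, i \in s & [set i.1; i.2] = [set x; y].
Proof.
elim: s => [_|[z q] s IHs] /=.
  by rewrite !mem_seq1 => /eqP-> /eqP->; rewrite adj_irr.
move=> [zs qs adjz ts].
have memE u : (u \in [:: r, z & unzip1 s]) = (u == z) || (u \in r :: unzip1 s).
  by rewrite !inE orbCA.
rewrite !memE => /predU1P[-> | xs] /predU1P[-> | ys].
- by rewrite adj_irr.
- by rewrite adjz // => /eqP->; exists (z, q); rewrite ?mem_head.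
- rewrite adj_sym adjz // => /eqP->; exists (z, q); rewrite ?mem_head //=.
  by rewrite setUC.
- case/(IHs ts xs ys) => i si <-.
  by exists i; rewrite // inE si orbT.
Qed.

(** The degree of [p] also counts [x] and, away from the root, the parent of [p]. The bound is the
    number of hyperedges guaranteed to the image of [p], so one is left for [x]. *)
Lemma tree_order_children r x p s :
    tree_order r ((x, p) :: s) ->
  count (fun i => i.2 == p) s < max_degree T - 1 + (p == r).
Proof.
move=> ts; have [_ ps _ _] := ts.
have := tree_order_degree ts (p := p); rewrite /= eqxx => /(_ _)/eqP.
have -> : p \in [:: r, x & unzip1 s].
  by move: ps; rewrite !inE => /orP[] ->; rewrite ?orbT.
move=> /(_ isT)/eqP degE.
have : count (adj p) (r :: unzip1 ((x, p) :: s)) <= max_degree T.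
  apply: leq_trans (leq_bigmax p); rewrite -size_filter /degree.
  rewrite -(card_uniqP _) ?filter_uniq ?(tree_order_uniq ts) //.
  apply: subset_leq_card; apply/subsetP=> y.
  by rewrite mem_filter inE => /andP[].
rewrite /= degE; case: (p == r) => /=; lia.
Qed.

Lemma tree_order_spanning r :
  is_tree T -> exists2 s, tree_order r s & forall x, x \in r :: unzip1 s.
Proof.
move=> [cT acT].
have [|| s ts sT] := @tree_order_exists (enum T) r acT; last first.
- by exists s => // x; rewrite sT mem_enum.
- by rewrite mem_enum.
move=> x y _ _; rewrite -(eq_connect (e := @adj T)) ?cT // => u v.
by rewrite /adj_in /= !mem_enum !andbT.
Qed.

Lemma tree_order_size r s :
  tree_order r s -> (forall x, x \in r :: unzip1 s) -> (size s).+1 = #|T|.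
Proof.
move=> ts sT; have /card_uniqP := tree_order_uniq ts.
by rewrite /= size_map => <-; apply: eq_card => x; rewrite sT.
Qed.

Lemma tree_order_two_leaves :
    is_tree T -> 2 < #|T| ->
  exists r z p w q s, [/\ tree_order r [:: (z, p), (w, q) & s],
    p \in r :: unzip1 s
    & forall x, x \in r :: unzip1 [:: (z, p), (w, q) & s]].
Proof.
move=> treeT T3; have [_ acT] := treeT.
have /card_gt0P[r0 _] : 0 < #|T| by apply: leq_trans T3.
have [s0 ts0 s0T] := tree_order_spanning r0 treeT.
have size_s0 := tree_order_size ts0 s0T.
case: s0 => [|[z p] s1] in ts0 s0T size_s0; first by rewrite -size_s0 in T3.
have [zs ps adjz ts1] := ts0.
(* Remove the leaf [z] and reorder the rest with its neighbour [p] as root: the last vertex [w] is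
   then a leaf other than [p]. *)
have [s2 ts2 s2E] := tree_order_exists acT (tree_order_connected ts1) ps.
have := perm_size (uniq_perm (tree_order_uniq ts2) (tree_order_uniq ts1) s2E).
case: s2 => [|[w q] s] in ts2 s2E *.
  by move: size_s0 T3; rewrite /= size_map => <- + [s10]; rewrite -s10.
move=> _; exists p, z, p, w, q, s; split; last first.
- move=> y; have := s0T y.
  by have := s2E y; rewrite /= !inE => s2Ey; rewrite orbCA -s2Ey orbCA.
- exact: mem_head.
- split=> // [||y]; rewrite ?s2E ?mem_head //.
  by move=> ys; rewrite adjz // -s2E.
Qed.

End TreeOrder.

(** * Maximal assignments of hyperedges to vertices *)

Section Assignment.

Variables (V : finType) (H : {set {set V}}) (m : nat).
Implicit Types (a : {ffun {set V} -> option V}) (e : {set V}) (v x y : V).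

Definition load a v := #|[set e | a e == Some v]|.

Definition assigned a := #|[set e | isSome (a e)]|.

Definition assignment a :=
  [forall e, forall v, (a e == Some v) ==> (e \in H) && (v \in e)]
  && [forall v, load a v <= m].

Lemma assignmentP a :
  reflect ((forall e v, a e = Some v -> e \in H /\ v \in e)
    /\ forall v, load a v <= m) (assignment a).
Proof.
apply: (iffP andP) => [[/forallP aH /forallP am] | [aH am]]; split=> //.
- by move=> e v /eqP aev; have /forallP/(_ v) := aH e; rewrite aev => /andP.
- apply/forallP=> e; apply/forallP=> v; apply/implyP=> /eqP/aH[].
  by move=> -> ->.
- exact/forallP.
Qed.

Definition reassign a e o : {ffun {set V} -> option V} :=
  [ffun e' => if e' == e then o else a e'].

Lemma load_reassign a e x v :
  a e = None -> load (reassign a e (Some x)) v = (x == v) + load a v.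
Proof.
move=> ae; rewrite /load; have [-> | xv] /= := eqVneq x v.
  rewrite (_ : [set _ | _] = e |: [set e' | a e' == Some v]).
    by rewrite cardsU1 inE ae.
  apply/setP=> e'; rewrite !inE ffunE; case: (e' =P e) => // _.
  by rewrite eqxx.
apply: eq_card => e'; rewrite !inE ffunE; case: (e' =P e) => // ->.
by rewrite ae; apply/eqP; case; apply/eqP.
Qed.

Lemma assigned_reassign a e x :
  a e = None -> assigned (reassign a e (Some x)) = (assigned a).+1.
Proof.
move=> ae; rewrite /assigned.
rewrite (_ : [set _ | _] = e |: [set e' | isSome (a e')]).
  by rewrite cardsU1 inE ae.
by apply/setP=> e'; rewrite !inE ffunE; case: eqP.
Qed.

Lemma reassignK a e x :
  a e = Some x -> reassign (reassign a e None) e (Some x) = a.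
Proof. by move=> ae; apply/ffunP=> e'; rewrite !ffunE; case: eqP => // ->. Qed.

(* If [a e = Some x] and [y \in e] then [e] can be moved from [x] to [y]. *)
Definition shift_rel a : rel V :=
  [rel x y | [exists e, (a e == Some x) && (y \in e)]].

(** Give [e] to [x] and release a hyperedge of [x] containing the next vertex of the path. All loads
    stay the same until the last vertex, which has room for one more. *)
Lemma augment a e x s :
    assignment a -> e \in H -> a e = None -> x \in e ->
    path (shift_rel a) x s -> uniq (x :: s) -> load a (last x s) < m ->
  exists2 a', assignment a' & assigned a' = (assigned a).+1.
Proof.
elim: s a e x => [|y s IHs] a e x /assignmentP[aH am] eH ae xe.
  move=> _ _ /= loadx; exists (reassign a e (Some x)).
    apply/assignmentP; split=> [e' v | v].
      by rewrite ffunE; case: eqP => [-> [<-] | _ /aH].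
    by rewrite load_reassign //; case: eqP => [<- | _] //; apply: am.
  exact: assigned_reassign.
case/andP=> /existsP[e1 /andP[/eqP ae1 ye1]] paths.
rewrite cons_uniq => /andP[xs Us] /= loads.
have ne1 : e != e1 by apply: contra_eq_neq ae => ->; rewrite ae1.
pose b := reassign a e1 None; pose a' := reassign b e (Some x).
have be : b e = None by rewrite ffunE (negPf ne1).
have be1 : b e1 = None by rewrite ffunE eqxx.
have loadE v : load a' v = load a v.
  (* Both [a] and [a'] arise from [b] by giving one hyperedge to [x]. *)
  by rewrite load_reassign // -(load_reassign _ _ be1) reassignK.
have a'e1 : a' e1 = None by rewrite ffunE eq_sym (negPf ne1).
have -> : assigned a = assigned a'.
  by rewrite -(reassignK ae1) !assigned_reassign.
have a'P : assignment a'.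
  apply/assignmentP; split=> [e' v|v]; last by rewrite loadE.
  rewrite !ffunE; case: eqP => [-> [<-] //|_].
  by case: eqP => // _ /aH.
have e1H : e1 \in H by have [] := aH _ _ ae1.
apply: (IHs a' e1 y) => //; last by rewrite loadE.
(* The rest of the path survives the change: it avoids [x], the only vertex to lose a hyperedge. *)
apply: (sub_in_path (P := predC1 x)) paths; last first.
  by apply/allP=> v vs; apply: contraNneq xs => <-.
move=> u v ux _ /existsP[e' /andP[/eqP ae' ve']]; apply/existsP; exists e'.
rewrite ve' andbT !ffunE; case: (e' =P e) => [ee'|_].
  by rewrite ee' ae in ae'.
case: (e' =P e1) => [ee'|_]; last by rewrite ae'.
by move: ux; rewrite ee' ae1 in ae'; case: ae' => ->; rewrite inE eqxx.
Qed.

(** The extra hyperedge at [v0] serves the root of the tree, which has no parent and so may have one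
    more child. The last clause keeps the greedy embedding inside [W]. *)
Definition private_system (W : {set V}) (v0 : V) (b : {set V} -> option V) :=
  [/\ v0 \in W, forall e v, b e = Some v -> e \in H /\ v \in e,
      {in W, forall v, m + (v == v0) <= #|[set e | b e == Some v]|}
    & forall e v, v \in W -> b e = Some v -> e \subset W].

Lemma private_system_exists :
    m * #|V| < #|H| -> {in H, forall e, 0 < #|e|} ->
  exists W v0 b, private_system W v0 b.
Proof.
move=> ltH H0.
have a0P : assignment [ffun=> None].
  apply/assignmentP; split=> [e v|v]; first by rewrite ffunE.
  by rewrite /load eq_card0 // => e; rewrite !inE ffunE.
case: (arg_maxnP assigned a0P) => a aP amax; have [aH am] := assignmentP _ aP.
have [e0 e0H ae0] : exists2 e, e \in H & a e = None.
  case: (boolP [exists e in H, a e == None]) => [/exists_inP[e eH /eqP]|].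
    by exists e.
  rewrite negb_exists_in => /forall_inP allH.
  suff : #|H| <= m * #|V| by rewrite leqNgt ltH.
  rewrite -sum1_card.
  (* Double counting: if every hyperedge were assigned, the loads would sum to at least [#|H|]. *)
  apply: (@leq_trans (\sum_(e in H) \sum_v (a e == Some v))).
    apply: leq_sum => e /allH; case: (a e) => // v _.
    by rewrite (bigD1 v) //= eqxx.
  rewrite exchange_big mulnC -sum_nat_const /=; apply: leq_sum => v _.
  apply: leq_trans (am v); rewrite -big_mkcondr sum1_card.
  by apply: subset_leq_card; apply/subsetP=> e; rewrite !inE => /andP[].
have /card_gt0P[v0 v0e0] := H0 _ e0H.
pose W := [set v | [exists x in e0, connect (shift_rel a) x v]].
have e0W : e0 \subset W.
  by apply/subsetP=> x xe; rewrite inE; apply/exists_inP; exists x.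
have Wload v : v \in W -> load a v = m.
  rewrite inE => /exists_inP[x xe0 /connectP[p0]].
  case/shortenP=> p pathp Up _ vE.
  apply/eqP; rewrite eqn_leq am leqNgt /= vE; apply/negP=> ltm.
  have [a' /amax] := augment aP e0H ae0 xe0 pathp Up ltm.
  by move=> + a'E; rewrite /= a'E ltnn.
exists W, v0, (reassign a e0 (Some v0)); split=> [|e v|v vW|e v vW].
- exact: (subsetP e0W).
- by rewrite ffunE; case: eqP => [-> [<-] | _ /aH].
- by rewrite -/(load _ v) load_reassign // Wload // addnC eq_sym.
(* The case of [e0] is [e0W]; any other hyperedge owned by [v] is a shift from [v] to each of its
   vertices. *)
rewrite ffunE; case: eqP => [-> _ // | _ aev]; apply/subsetP=> u ue.
move: vW; rewrite !inE => /exists_inP[x xe0 xv].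
apply/exists_inP; exists x => //.
apply: connect_trans xv (connect1 _).
by apply/existsP; exists e; rewrite aev eqxx.
Qed.

End Assignment.


(** * Choosing new vertices in two hyperedges at once *)

(** Fix a new [y] in [e2]. If [e1] offers no new vertex other than [y], then [e1 = y |: A] by
    cardinality, and a point of [e2] outside [e1] can replace [y]. *)
Lemma distinct_representatives (V : finType) (A e1 e2 : {set V}) :
    e1 != e2 -> #|e1| = #|e2| -> #|A| < #|e1| ->
  exists x y, [/\ x \in e1 :\: A, y \in e2 :\: A & x != y].
Proof.
move=> ne12 card12 ltA.
have diff0 (B e : {set V}) : #|B| < #|e| -> exists x, x \in e :\: B.
  move=> ltB; apply/set0Pn; rewrite setD_eq0.
  by apply: contraTN ltB => /subset_leq_card; rewrite -leqNgt.
have [y y2] : exists y, y \in e2 :\: A by apply: diff0; rewrite -card12.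
have [/subsetP sub1 | ] := boolP (e1 \subset y |: A); last first.
  case/subsetPn=> x x1; rewrite in_setU1 negb_or => /andP[xy xA].
  by exists x, y; rewrite inE xA x1.
have e1E : e1 = y |: A.
  apply/eqP; rewrite eqEcard; apply/andP; split; first by apply/subsetP.
  by rewrite (leq_trans _ ltA) // cardsU1; case: (y \in A).
have [x x1] := diff0 A e1 ltA.
have /subsetPn[z z2 zn1] : ~~ (e2 \subset e1).
  by apply: contra ne12 => sub21; rewrite eq_sym eqEcard sub21 card12 leqnn.
exists x, z; split=> //; last by apply: contraNneq zn1 => <-; case/setDP: x1.
by rewrite inE z2 andbT; apply: contra zn1 => zA; rewrite e1E !inE zA orbT.
Qed.

(** * Greedy embedding of the tree *)

Section Embedding.

Variables (T : sgraph) (r : T) (V : finType) (H : {set {set V}}) (k : nat).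
Variables (W : {set V}) (v0 : V) (b : {set V} -> option V).
Hypothesis cardH : {in H, forall e : {set V}, #|e| = k}.
Hypothesis bP : private_system H (max_degree T - 1) W v0 b.
Implicit Types (s : seq (T * T)) (phi : T -> V) (F : T * T -> {set V}).

Definition owned s phi F := {in s, forall i, b (F i) = Some (phi i.2)}.

(** [F i] is the hyperedge for the edge between [i.1] and [i.2]. It contains [phi i.2] because that
    vertex owns it. *)
Definition embedding s phi F :=
  [/\ phi r = v0, {in r :: unzip1 s &, injective phi},
      {in r :: unzip1 s, forall x, phi x \in W}, {in s &, injective F}
    & owned s phi F /\ {in s, forall i, phi i.1 \in F i}].

Definition extend (A : eqType) (B : Type) (f : A -> B) a c : A -> B :=
  fun x => if x == a then c else f x.

(** By injectivity, the used hyperedges of [phi p] belong to earlier children of [p], and these are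
    too few. Only the vertices of [A] need images: children in [s] may still be unplaced. *)
Lemma fresh_hyperedge s x p (A : seq T) phi F :
    tree_order r ((x, p) :: s) -> {in A &, injective phi} -> r \in A ->
    p \in A -> {subset unzip2 s <= A} -> phi r = v0 -> phi p \in W ->
    owned s phi F ->
  exists2 e, b e = Some (phi p) & e \notin map F s.
Proof.
move=> ts phiI rA pA sA phir pW sF; have [_ _ bload _] := bP.
pose U := [seq F i | i <- s & i.2 == p].
have ltU : size U < #|[set e | b e == Some (phi p)]|.
  apply: leq_trans (bload _ pW); rewrite size_map size_filter -phir.
  rewrite (inj_in_eq phiI) //; exact: tree_order_children ts.
have /subsetPn[e] : ~~ ([set e | b e == Some (phi p)] \subset U).
  apply: contraTN ltU => /subset_leq_card leU; rewrite -leqNgt.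
  exact: leq_trans leU (card_size _).
rewrite inE => /eqP bep eU; exists e => //.
apply: contra eU => /mapP[i si eE]; apply/mapP; exists i => //.
rewrite mem_filter si andbT; apply/eqP/phiI => //; first exact/sA/map_f.
by have := sF _ si; rewrite -eE bep => -[].
Qed.

Lemma embedding_extend s x p phi F e y :
    tree_order r ((x, p) :: s) -> embedding s phi F -> b e = Some (phi p) ->
    e \notin map F s -> y \in e -> y \notin map phi (r :: unzip1 s) ->
  embedding ((x, p) :: s) (extend phi x y) (extend F (x, p) e).
Proof.
move=> ts [phir phiI phiW FI [sF sphi]] bep eF ye yphi.
have [xs ps _ ts'] := ts; have [_ _ _ bW] := bP.
have memE z :
    (z \in r :: unzip1 ((x, p) :: s)) = (z == x) || (z \in r :: unzip1 s).
  by rewrite /= !inE orbCA.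
have phiE z : z \in r :: unzip1 s -> extend phi x y z = phi z.
  by rewrite /extend; case: eqP => // -> xin; rewrite xin in xs.
have phix : extend phi x y x = y by rewrite /extend eqxx.
have FE i : i \in s -> extend F (x, p) e i = F i.
  rewrite /extend; case: eqP => // -> si; case/negP: xs.
  by rewrite inE (map_f fst si) orbT.
have Fx : extend F (x, p) e (x, p) = e by rewrite /extend eqxx.
have s1 i : i \in s -> i.1 \in r :: unzip1 s.
  by move=> si; rewrite inE (map_f fst si) orbT.
split; last split.
- by rewrite phiE ?mem_head.
- move=> u v; rewrite !memE => /predU1P[-> | us] /predU1P[-> | vs] //.
  + by rewrite phix phiE // => yE; rewrite yE map_f in yphi.
  + by rewrite phix phiE // => yE; rewrite -yE map_f in yphi.
  + by rewrite !phiE //; apply: phiI.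
- move=> u; rewrite memE => /predU1P[-> | us]; last by rewrite phiE ?phiW.
  by rewrite phix (subsetP (bW _ _ (phiW _ ps) bep)).
- move=> i j; rewrite !inE => /predU1P[-> | si] /predU1P[-> | sj] //.
  + by rewrite Fx FE // => eE; rewrite eE map_f in eF.
  + by rewrite Fx FE // => eE; rewrite -eE map_f in eF.
  + by rewrite !FE //; apply: FI.
- move=> i; rewrite inE => /predU1P[-> | si]; first by rewrite Fx phiE.
  by rewrite FE // phiE ?sF // (tree_order_parent ts').
- move=> i; rewrite inE => /predU1P[-> | si]; first by rewrite Fx phix.
  by rewrite FE // phiE ?sphi ?s1.
Qed.

Lemma embedding_fresh s x p phi F :
    tree_order r ((x, p) :: s) -> embedding s phi F ->
  exists2 e, b e = Some (phi p) & e \notin map F s.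
Proof.
move=> ts [phir phiI phiW _ [sF _]]; have [_ ps _ ts'] := ts.
apply: fresh_hyperedge ts phiI (mem_head _ _) ps _ phir (phiW _ ps) sF.
by move=> z /mapP[i si ->]; apply: tree_order_parent si.
Qed.

Lemma card_owned e v : b e = Some v -> #|e| = k.
Proof. by case: bP => _ bH _ _ /bH[/cardH]. Qed.

Lemma embedding_exists s :
  tree_order r s -> size s < k -> exists phi F, embedding s phi F.
Proof.
elim: s => [_ _|[x p] s IHs ts ltk].
  exists (fun=> v0), (fun=> set0); split=> // [x y | x _]; last by case: bP.
  by rewrite !mem_seq1 => /eqP-> /eqP->.
have [_ _ _ ts'] := ts; have [phi [F emb]] := IHs ts' (ltnW ltk).
have [e bep eF] := embedding_fresh ts emb.
(* Here [k] is the size of a hyperedge, and only [size s + 1 < k] vertices are placed so far. *)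
have /subsetPn[y ye yphi] : ~~ (e \subset map phi (r :: unzip1 s)).
  apply: contraTN ltk => /subset_leq_card; rewrite (card_owned bep) -leqNgt.
  move=> lek; apply: leq_trans lek (leq_trans (card_size _) _).
  by rewrite /= !size_map.
by do 2!eexists; apply: embedding_extend ts emb bep eF ye yphi.
Qed.

(* The last two children being leaves, their hyperedges can be chosen before
   their images, and being distinct these two hyperedges cannot both force the
   same single image. *)
Lemma embedding_two_leaves s z p w q :
    tree_order r [:: (z, p), (w, q) & s] -> p \in r :: unzip1 s ->
    (size s).+2 <= k ->
  exists phi F, embedding [:: (z, p), (w, q) & s] phi F.
Proof.
move=> ts ps lek; have [zs _ _ ts1] := ts; have [ws qs _ ts2] := ts1.
have [phi [F emb]] := embedding_exists ts2 (ltnW lek).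
have [e1 be1 e1F] := embedding_fresh ts1 emb.
have [phir phiI phiW FI [sF sphi]] := emb.
pose F1 := extend F (w, q) e1.
have sF1 : owned ((w, q) :: s) phi F1.
  move=> i; rewrite inE /F1 /extend; case: eqP => [-> //|_ /=]; exact: sF.
have par1 : {subset unzip2 ((w, q) :: s) <= r :: unzip1 s}.
  move=> u /= /predU1P[-> // | /mapP[i si ->]]; exact: tree_order_parent si.
(* [w] has no image yet, but no parent so far is [w], so [phi] is known wherever it is needed. *)
have [e2 be2 e2F] :=
  fresh_hyperedge ts phiI (mem_head _ _) ps par1 phir (phiW _ ps) sF1.
have ne12 : e1 != e2.
  apply: contraNneq e2F => <-; apply/mapP; exists (w, q); rewrite ?mem_head //.
  by rewrite /F1 /extend eqxx.
have [||y1 [y2 [/setDP[y11 y1A] /setDP[y22 y2A] ney]]] :=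
  distinct_representatives (A := [set x in map phi (r :: unzip1 s)]) ne12.
- by rewrite (card_owned be1) (card_owned be2).
(* Both hyperedges only have to exceed the [size s + 1] placed vertices, so [size s + 2 <= k]
   suffices. *)
- rewrite (card_owned be1) cardsE; apply: leq_ltn_trans (card_size _) _.
  by rewrite /= !size_map.
rewrite in_set in y1A; rewrite in_set in y2A.
have emb1 := embedding_extend ts1 emb be1 e1F y11 y1A.
have phi1E u : u \in r :: unzip1 s -> extend phi w y1 u = phi u.
  by rewrite /extend; case: eqP => // -> win; rewrite win in ws.
do 2!eexists; apply: embedding_extend ts emb1 _ e2F y22 _.
  by rewrite phi1E.
apply: contra y2A => /mapP[u].
have -> : (u \in r :: unzip1 ((w, q) :: s)) = (u == w) || (u \in r :: unzip1 s).
  by rewrite /= !inE orbCA.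
case/predU1P=> [-> | us].
  by rewrite /extend eqxx => /esym/eqP; rewrite (negPf ney).
by rewrite phi1E // => ->; rewrite map_f.
Qed.

Lemma embedding_contains_berge s phi F :
    tree_order r s -> (forall x, x \in r :: unzip1 s) -> embedding s phi F ->
  contains_berge T H.
Proof.
move=> ts sT [_ phiI _ FI [sF sphi]]; have [_ bH _ _] := bP.
(* Recovers the (child, parent) pair from an edge; the default [(r, r)] never occurs on
   [edges T]. *)
pose item A := nth (r, r) s (find (fun i => [set i.1; i.2] == A) s).
have itemP A : A \in edges T ->
    item A \in s /\ [set (item A).1; (item A).2] = A.
  case/imsetP=> -[x y]; rewrite inE /= => xy ->.
  have [i si iE] := tree_order_edge ts (sT x) (sT y) xy.
  have has_i : has (fun i => [set i.1; i.2] == [set x; y]) s.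
    by apply/hasP; exists i; rewrite ?iE.
  split; first by rewrite mem_nth // -has_find.
  by have /eqP := nth_find (r, r) has_i.
have adjE x y : adj x y -> [set x; y] \in edges T.
  by move=> xy; apply/imsetP; exists (x, y); rewrite ?inE.
apply/contains_bergeP; exists phi, (fun A => F (item A)); split.
- by move=> x y; apply: phiI.
- move=> A B /itemP[sA AE] /itemP[sB BE] /FI eqi.
  by rewrite -AE -BE eqi.
- by move=> A /itemP[sA _]; have [] := bH _ _ (sF _ sA).
move=> x y /adjE/itemP[]; set i := item _ => si iE.
have -> : [set phi x; phi y] = phi @: [set i.1; i.2].
  by rewrite iE imsetU1 imset_set1.
have [_ Fi2] := bH _ _ (sF _ si).
by rewrite imsetU1 imset_set1 subUset !sub1set sphi.
Qed.

End Embedding.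

(* [max_degree T] is positive since a tree with k >= 1 edges has an edge, so the
   natural-number subtraction is exact. *)
Theorem theorem9 (k r : nat) (hk : 1 <= k) (hr : 2 <= r)
    (T : sgraph) (hT : is_tree T) (hcard : #|T| = k + 1) (hkr : k <= r)
    (n : nat) (hn : 0 < n) :
  ex_berge r n T <= (max_degree T - 1) * n.
Proof.
apply/bigmax_leqP => H /andP[/forall_inP unifH]; rewrite leqNgt; apply: contra.
rewrite -{1}(card_ord n) => ltH.
have cardH : {in H, forall e : {set _}, #|e| = r} by move=> e /unifH/eqP.
have [|W [v0 [b bP]]] := private_system_exists ltH.
  by move=> e /cardH->; apply: ltnW.
case: (ltnP 1 k) => [k2 | k1].
  have [|x [z [p [w [q [s [ts ps sT]]]]]]] := tree_order_two_leaves hT.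
    by rewrite hcard addn1.
  have size_s : (size s).+2 <= r.
    by have := tree_order_size ts sT; rewrite hcard /= addn1 => -[->].
  have [phi [F emb]] := embedding_two_leaves cardH bP ts ps size_s.
  exact: (embedding_contains_berge bP ts sT emb).
(* For [k = 1] the tree is a single edge, and [2 <= r] leaves room for both ends without the
   treatment of two leaves. *)
have /card_gt0P[x _] : 0 < #|T| by rewrite hcard addn1.
have [s ts sT] := tree_order_spanning x hT.
have [|phi [F emb]] := embedding_exists cardH bP ts.
  have := tree_order_size ts sT; rewrite hcard addn1 => -[->].
  exact: leq_ltn_trans k1 hr.
exact: (embedding_contains_berge bP ts sT emb).
Qed.
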